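(* There exist nonnegative integers $a,b,c$, independent of all data below, such that the following holds. Let $X$ be an inner product space (with induced norm $\|\cdot\|$). Let $(x_n),(y_n)$ be the sequences generated by the stochastic Halpern-Mann iteration $$y_n:=(1-\alpha_n)(Tx_n+\xi_n)+\alpha_nu,\qquad x_{n+1}:=(1-\beta_n)(Uy_n+\delta_n)+\beta_ny_n$$ with parameters $\alpha_n=\frac{2}{n+2}$ and $\beta_n=\beta\in(0,1)$ for all $n\in\mathbb{N}$. Let $p\in X$ be a common fixed point of $T$ and $U$, let $K_0>0$ satisfy $K_0\ge\mathbb{E}[\|x_0-p\|]$ and $K_0\ge\mathbb{E}[\|u-p\|]$, let $D\ge\sum_{n=0}^\infty\mathbb{E}[\|\delta_n\|]$ and $E\ge\sum_{n=0}^\infty\mathbb{E}[\|\xi_n\|]$ be real numbers, and put $K:=4K_0+2D+2E$. Assume that $\mathbb{E}[\|\xi_n\|]\le K_1/(n+2)^2$ and $\mathbb{E}[\|\delta_n\|]\le K_2/(n+2)^2$ for all $n\in\mathbb{N}$, and let $\Lambda>0$ be such that $\Lambda\le\beta\le1-\Lambda$. Put $L:=aK+bK_1+cK_2$. Then $\|Ux_n-x_n\|\to0$ and $\|Tx_n-x_n\|\to0$ almost surely with rates $$\Phi_1(\lambda,\varepsilon):=\left\lceil\frac{24KL}{\Lambda^2\varepsilon^2\lambda^2}\right\rceil\qquad\text{and}\qquad\Phi_2(\lambda,\varepsilon):=\left\lceil\frac{72KL}{\Lambda^2\varepsilon^2\lambda^2}\right\rceil,$$ respectively. Given a modulus $\mu$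 of uniform integrability for $(\|Uy_n-y_n\|)$, further $\mathbb{E}[\|Ux_n-x_n\|]\to0$ and $\mathbb{E}[\|Tx_n-x_n\|]\to0$ with respective rates $$\varphi_1(\varepsilon):=\left\lceil\frac{96KL}{\Lambda^2\varepsilon^2\mu(\varepsilon/4)^2}\right\rceil\qquad\text{and}\qquad\varphi_2(\varepsilon):=\left\lceil\frac{288KL}{\Lambda^2\varepsilon^2\mu(\varepsilon/4)^2}\right\rceil.$$
   Context: $\mathbb{N}=\{0,1,2,\dots\}$. $(\Omega,\mathcal{F},\mathbb{P})$ is a probability space, $X$ is real and separable, and an $X$-valued random variable is a measurable function $\Omega\to X$. $T,U:X\to X$ are nonexpansive ($\|Tx-Ty\|\le\|x-y\|$, $\|Ux-Uy\|\le\|x-y\|$ for all $x,y\in X$); $x_0$ (the starting point) and $u$ (the anchor) are $X$-valued random variables; $(\xi_n),(\delta_n)$ are sequences of $X$-valued random variables; $K_1,K_2\ge0$ are real constants. A modulus of uniform integrability for a sequence of random variables $(X_n)$ with $\sup_n\mathbb{E}[|X_n|]<\infty$ is a function $\mu:(0,\infty)\to(0,\infty)$ such that for all $\varepsilon>0$, $n\in\mathbb{N}$ and $A\in\mathcal{F}$: $\mathbb{P}(A)\le\mu(\varepsilon)$ implies $\mathbb{E}[|X_n|1_A]\le\varepsilon$. For nonnegative reals $(a_n)$, a rate for $a_n\to0$ is a function $\varphi:(0,\infty)\to\mathbb{N}$ with $a_n<\varepsilon$ for all $\varepsilon>0$ and $n\ge\varphi(\varepsilon)$. For nonnegative random variables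 $(X_n)$, a rate for $X_n\to0$ almost surely is a function $\Phi:(0,\infty)^2\to\mathbb{N}$ with $\mathbb{P}(\exists n\ge\Phi(\lambda,\varepsilon)\,(X_n\ge\varepsilon))<\lambda$ for all $\lambda,\varepsilon>0$.
   Formalization: For the rates in mean, the modulus μ of uniform integrability is additionally required to take values in (0,1]; with arbitrary positive values the stated rates are false, and replacing μ by min(μ,1) always gives such a modulus. *)

(* Defs.v *)
From HB Require Import structures.
From mathcomp Require Export all_boot all_order all_algebra.
From mathcomp Require Export all_classical all_reals all_analysis.
Export Order.TTheory GRing.Theory Num.Theory.
Export numFieldNormedType.Exports.

Set Implicit Arguments.
Unset Strict Implicit.
Unset Printing Implicit Defensive.

Local Open Scope classical_set_scope.
Local Open Scope ring_scope.

(* The carrier of X equipped with its Borel sigma-algebra; an X-valued random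
   variable is then an element of {RV P >-> borel X}. *)
Notation borel X := (g_sigma_algebraType (@open X)).

Definition separable_space (X : topologicalType) : Prop :=
  exists2 A : set X, countable A & dense A.

(* The norm of X is the one induced by the (real) inner product dot. Neither
   completeness nor finite dimension of X is required. *)
Definition induced_norm (R : realType) (X : normedModType R)
    (dot : {dot X for idfun}) : Prop :=
  forall x : X, `|x| = Num.sqrt (dot x x).

Definition nonexpansive (R : realType) (X : normedModType R) (f : X -> X) :
    Prop :=
  forall x y : X, `|f x - f y| <= `|x - y|.

(* Meant for 0 <= x, where the absolute value on int is just the cast to nat. *)
Definition nat_ceil (R : realType) (x : R) : nat := `|Num.ceil x|%N.

(* Arguments of rates and moduli range over (0, +oo); values of the Rocq
   functions at other reals are irrelevant. *)
Definition is_rate (R : realType) (a : nat -> \bar R) (phi : R -> nat) : Prop :=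
  forall e : R, 0 < e -> forall n : nat, (phi e <= n)%N -> (a n < e%:E)%E.

Definition is_as_rate d (Omega : measurableType d) (R : realType)
    (P : probability Omega R) (Z : nat -> Omega -> R) (Phi : R -> R -> nat) :
    Prop :=
  forall l e : R, 0 < l -> 0 < e ->
    (P [set w | exists n : nat, (Phi l e <= n)%N /\ (e <= Z n w)%R] < l%:E)%E.

Definition cvg0_with_rate (R : realType) (a : nat -> \bar R)
    (phi : R -> nat) : Prop :=
  (a n @[n --> \oo] --> 0%E) /\ is_rate a phi.

Definition as_cvg0_with_rate d (Omega : measurableType d) (R : realType)
    (P : probability Omega R) (Z : nat -> Omega -> R) (Phi : R -> R -> nat) :
    Prop :=
  {ae P, forall w, Z n w @[n --> \oo] --> (0 : R)} /\ is_as_rate P Z Phi.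

Definition ui_modulus d (Omega : measurableType d) (R : realType)
    (P : probability Omega R) (Z : nat -> Omega -> R) (mu : R -> R) : Prop :=
  [/\ (ereal_sup (range (fun n => 'E_P[fun w => `|Z n w|%R])) < +oo)%E,
      forall e : R, 0 < e -> 0 < mu e &
      forall (e : R) (n : nat) (A : set Omega), 0 < e -> measurable A ->
        (P A <= (mu e)%:E)%E ->
        ('E_P[fun w => (`|Z n w| * \1_A w)%R] <= e%:E)%E].

(* Main.v *)
Require Import Defs.
From mathcomp Require Import ssrAC measurable_realfun ring lra.

Set Implicit Arguments.
Unset Strict Implicit.
Unset Printing Implicit Defensive.

Local Open Scope classical_set_scope.
Local Open Scope ring_scope.

(** Everything is controlled, realization by realization, by two functionals
    of the data that are linear in the noise.  Write s_k for
    |xi_k| + |delta_k| and let M be |x_0 - p| + |u - p| + sum_k s_k, which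
    bounds all |x_n - p| and |y_n - p|.

    The steps a_n = |x_{n+1} - x_n| satisfy
    a_{n+1} <= (1 - alpha_{n+1}) a_n + s_n + s_{n+1}
               + 2 M (alpha_n - alpha_{n+1}).
    As alpha_n = 2/(n+2), multiplying by (n+2)(n+3) makes this telescope, and
    a_n is at most 4M/(n+2) plus the sum of the s_k + s_{k+1} with weights
    (k+2)(k+3)/((n+1)(n+2)).  These weights decrease in n and stay below 1 for
    k < n, so that S_N = M/(N+2) + sum_k min(1, (k+2)(k+3)/((N+1)(N+2))) s_k
    bounds a_n / 4 for all n >= N at once ([step_small]).  This uniformity is
    what an almost sure rate needs; a bound on each E[a_n] would not do.

    The inner product enters once: the identity for the square norm of a
    convex combination ([sqr_norm_convex]) turns the fact that
    |x_{n+1} - p| is not much smaller than |y_n - p| into the bound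
    Lambda^2 |U y_n + delta_n - y_n|^2 <= 16 S_N M for n >= N
    ([UyD_small]).  Both residuals are then at most 11 G / Lambda, where
    G = t S_N + M/t and t > 0 is arbitrary ([resU_small], [resT_small]).
    Using t in place of the square root of S_N M keeps the bound linear in the
    noise, so that only first moments are involved: E[M] <= K/2 by hypothesis,
    and E[S_N] <= (K/2 + 4(K_1 + K_2))/(N+2) because the weights divided by
    (k+2)^2 sum up to at most 4/(N+2) ([weight_mass]).

    Hence sup_{n >= N} of a residual is dominated by a function of integral at
    most A t/(N+2) + B/t ([envelope_dominates]).  With t = 2B/eta this is
    smaller than eta as soon as 4AB/eta^2 < N+2.  The choice
    eta = lambda epsilon and Markov's inequality give the almost sure rates
    ([dominated_as_rate]), and eta = epsilon gives rates in mean
    ([dominated_mean_rate]); as mu <= 1, the rates of the theorem are larger.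
    Here 4AB = 242 K (K/2 + 4(K_1 + K_2)) / Lambda^2, and a = 6, b = c = 44
    make 24 K L exceed this.  Convergence itself follows from the rates.

    Measurability of the iterates rests on separability: the sum of two Borel
    random variables is measurable when open sets are countable unions of
    balls ([measurable_add]). *)

(** * Borel random variables in a separable normed space *)

Section borel.
Context (R : realType) (X : normedModType R).
Context d (Omega : measurableType d).

Lemma borel_open (V : set X) : open V -> measurable (V : set (borel X)).
Proof. by move=> oV; apply: sub_sigma_algebra. Qed.

Lemma measurable_continuous_comp (h : X -> X) (f : Omega -> borel X) :
  continuous h -> measurable_fun setT f ->
  measurable_fun setT (fun w => h (f w) : borel X).
Proof.
move=> /continuousP hc mf.
apply: (@measurability _ _ _ (borel X) _ _ (@open X)) => //.
move=> _ [V oV <-].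
exact: (mf measurableT (h @^-1` V) (borel_open (hc _ oV))).
Qed.

Lemma measurable_norm (f : Omega -> borel X) :
  measurable_fun setT f -> measurable_fun setT (fun w => `|(f w : X)|).
Proof.
move=> mf; apply: (measurability (@RGenOpens.G R)); first exact: RGenOpens.measurableE.
move=> _ [_ [a [c ->]] <-].
have nc : open ((fun z : X => `|z|) @^-1` [set` `]a, c[]).
  move: (@norm_continuous R X) => /continuousP; apply.
  exact: interval_open.
by have := mf measurableT _ (borel_open nc).
Qed.

(** In a space that is not separable, the sum of two Borel measurable functions
    need not be Borel measurable.  With a countable dense set, the event
    that the sum lies in an open set is a countable union of events that each
    summand lies in a small ball around a point of this set. *)
Lemma measurable_add (f g : Omega -> borel X) : separable_space X ->
  measurable_fun setT f -> measurable_fun setT g ->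
  measurable_fun setT (fun w => (f w : X) + (g w : X) : borel X).
Proof.
move=> [A cA dA] mf mg.
apply: (@measurability _ _ _ (borel X) _ _ (@open X)) => //.
move=> _ [V oV <-]; rewrite setTI.
pose rad (k : nat) : R := k.+1%:R^-1.
pose good := [set i : nat * X * X | [/\ A i.1.2, A i.2 &
  ball (i.1.2 + i.2) (2 * rad i.1.1) `<=` V]].
have -> : (fun w => (f w : X) + (g w : X)) @^-1` V = \bigcup_(i in good)
    (f @^-1` ball i.1.2 (rad i.1.1) `&` g @^-1` ball i.2 (rad i.1.1)).
  apply/seteqP; split=> [w /= Vw|w [[[k a] b] /= [Aa Ab sV] [fa gb]]]; last first.
    apply: sV; rewrite -ball_normE /= opprD addrACA.
    move: fa gb; rewrite -!ball_normE /= => fa gb.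
    by rewrite (le_lt_trans (ler_normD _ _))// mulr_natl mulr2n ltrD.
  have : nbhs ((f w : X) + (g w : X)) V by exact: open_nbhs_nbhs.
  move=> /nbhs_ballP[e /= e0 eV].
  have [k ke] : exists k, 4 * rad k < e.
    have e4 : 0 < e / 4 by rewrite divr_gt0.
    near \oo => k; exists k; rewrite mulrC -ltr_pdivlMr//.
    by near: k; exact: near_infty_natSinv_lt (PosNum e4).
  have k0 : 0 < rad k by rewrite invr_gt0.
  have pick z : exists2 a, A a & ball z (rad k) a.
    have [] := dA (ball z (rad k)) _ (ball_open z (rad k)).
      by exists z; exact: ballxx.
    by move=> a [za Aa]; exists a.
  have [a Aa fa] := pick (f w); have [b Ab gb] := pick (g w).
  exists (k, a, b) => /=; last by split; exact: ball_sym.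
  split=> // z; rewrite -ball_normE /= => abz; apply: eV.
  move: fa gb; rewrite -!ball_normE /= => fa gb.
  have := ler_distD (a + b) ((f w : X) + (g w : X)) z.
  have := ler_normD ((f w : X) - a) ((g w : X) - b).
  by rewrite addrACA -opprD; lra.
rewrite bigcup_set_type; apply: countable_bigcupT_measurable; last first.
  move=> i; rewrite -(setTI (_ @^-1` _)) -(setTI (g @^-1` _)).
  apply: measurableI; [apply: mf|apply: mg] => //.
    by apply: borel_open; exact: ball_open.
  by apply: borel_open; exact: ball_open.
rewrite (eq_countable (card_setT good)).
have : countable (([set: nat] `*` A) `*` A) by exact/countableX/cA/countableX.
by apply: sub_countable; apply: subset_card_le => -[[k a] b] [].
Unshelve. all: by end_near.
Qed.
End borel.

Lemma nonexpansive_continuous (R : realType) (X : normedModType R) (f : X -> X) :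
  nonexpansive f -> continuous f.
Proof.
move=> fne z; apply/cvgrPdist_lt => e e0; near=> v.
by rewrite (le_lt_trans (fne _ _)).
Unshelve. all: by end_near.
Qed.

(** * Convex combinations in inner product spaces *)

(** The only place where the norm has to come from an inner product. *)
Lemma sqr_norm_convex (R : realType) (X : normedModType R)
    (dot : {dot X for idfun}) (b : R) (v w : X) : induced_norm dot ->
  `|(1 - b) *: v + b *: w| ^+ 2 =
  (1 - b) * `|v| ^+ 2 + b * `|w| ^+ 2 - b * (1 - b) * `|v - w| ^+ 2.
Proof.
move=> hdot.
have dot_ge0 z : 0 <= dot z z.
  have [->|z0] := eqVneq z 0; first by rewrite linear0l.
  exact/ltW/neq0_dnorm_gt0.
have sq z : `|z| ^+ 2 = dot z z by rewrite hdot sqr_sqrtr.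
have sym : dot w v = dot v w by rewrite hermC expr0 mul1r.
have Zl c z z' : dot (c *: z) z' = c * dot z z' by rewrite linearZl_LR.
have Zr c z z' : dot z (c *: z') = c * dot z z' by rewrite linearZr_LR.
rewrite !sq !(linearDl, linearDr, linearNl, linearNr) /=.
rewrite !(Zl, Zr) sym; ring.
Qed.

Lemma affine_comb_sub (R : realType) (X : normedModType R) (c : R) (v w z : X) :
  (1 - c) *: v + c *: w - z = (1 - c) *: (v - z) + c *: (w - z).
Proof.
by rewrite !scalerBr addrACA -opprD -scalerDl subrK scale1r.
Qed.

Lemma norm_affine_comb_le (R : realType) (X : normedModType R) (c : R) (v w : X) :
  0 <= c <= 1 -> `|(1 - c) *: v + c *: w| <= (1 - c) * `|v| + c * `|w|.
Proof.
move=> /andP[c0 c1]; rewrite (le_trans (ler_normD _ _))// !normrZ.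
by rewrite !ger0_norm ?subr_ge0.
Qed.

(** For consecutive iterates, [v] and [v'] are images under [T].  Their
    difference carries the newer coefficient [1 - c'], so that the recursion
    for the steps contracts. *)
Lemma affine_comb_diff (R : realType) (X : normedModType R) (c c' : R)
    (v v' e e' w : X) :
  ((1 - c') *: (v' + e') + c' *: w) - ((1 - c) *: (v + e) + c *: w) =
  (1 - c') *: (v' - v) + (1 - c') *: e' - (1 - c) *: e + (c - c') *: (v - w).
Proof.
have -> : (c - c') *: (v - w) = (1 - c') *: v - (1 - c) *: v + (c' *: w - c *: w).
  by rewrite -!scalerBl scalerBr -scaleNr; congr (_ *: _ + _ *: _); ring.
rewrite !(scalerDr, scalerN) !opprD.
rewrite !addrA [RHS](ACl ((1*3*7)*(6*4*8)*(5*2))) /= subrr addr0.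
by rewrite !addrA.
Qed.

(** * Damping of the noise *)

(** The factor with which the noise at time [k] survives in a step at or after
    time [N]: noise before [N] has been damped by the averaging, later noise
    has not. *)
Definition weight (R : realType) (N k : nat) : R :=
  Num.min 1 ((k%:R + 2) * (k%:R + 3) / ((N%:R + 1) * (N%:R + 2))).

Section weight.
Context (R : realType).
Implicit Types N n k : nat.

Lemma weight_ge0 N k : 0 <= weight R N k.
Proof.
by rewrite le_min ler01 divr_ge0// mulr_ge0// addr_ge0.
Qed.

Lemma weight_le1 N k : weight R N k <= 1.
Proof. by rewrite ge_min lexx. Qed.

Lemma weight_le N k :
  weight R N k <= (k%:R + 2) * (k%:R + 3) / ((N%:R + 1) * (N%:R + 2)).
Proof. by rewrite ge_min lexx orbT. Qed.

Lemma weight_late N k : (N <= k)%N -> weight R N k = 1.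
Proof.
move=> Nk; apply/min_idPl; have N0 := ler0n R N.
have : N%:R <= k%:R :> R by rewrite ler_nat.
by move=> h; rewrite ler_pdivlMr; nra.
Qed.

Lemma weight_leS N k : weight R N k <= weight R N k.+1.
Proof.
rewrite le_min weight_le1 (le_trans (weight_le _ _))//.
apply: ler_wpM2r; first by rewrite invr_ge0 mulr_ge0 ?addr_ge0.
by have := ler0n R k; rewrite -(natr1 k); nra.
Qed.

(** The weights at [N] serve all later times [n], so that one random variable
    dominates all steps from [N] on. *)
Lemma weight_dom N n k : (N <= n)%N -> (k < n)%N ->
  (k%:R + 2) * (k%:R + 3) <= weight R N k * ((n%:R + 1) * (n%:R + 2)).
Proof.
move=> Nn kn; have N0 := ler0n R N; have k0 := ler0n R k.
have Nn' : N%:R <= n%:R :> R by rewrite ler_nat.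
have kn' : k%:R + 1 <= n%:R :> R by rewrite natr1 ler_nat.
have n12 : 0 < (n%:R + 1) * (n%:R + 2) :> R by rewrite mulr_gt0// ltr_wpDl.
have N12 : 0 < (N%:R + 1) * (N%:R + 2) :> R by rewrite mulr_gt0// ltr_wpDl.
rewrite -ler_pdivrMr// le_min ler_pdivrMr// mul1r.
apply/andP; split; first by nra.
rewrite ler_wpM2l ?mulr_ge0 ?addr_ge0// lef_pV2 ?posrE//; nra.
Qed.

End weight.

(** Before [N] each term is at most [3/2 / ((N+1)(N+2))], and there are [N] of
    them; from [N] on the weight is bounded by 1 and the terms by the
    telescoping [1/(k+1) - 1/(k+2)].  Both parts are of order [1/N]. *)
Lemma weight_mass (R : realType) (N n : nat) :
  \sum_(k < n) weight R N k / (k%:R + 2) ^+ 2 <= 4 / (N%:R + 2).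
Proof.
have N0 := ler0n R N; set c : R := 3 / 2 / ((N%:R + 1) * (N%:R + 2)).
have N1p : 0 < N%:R + 1 :> R by rewrite ltr_wpDl.
have N2p : 0 < N%:R + 2 :> R by rewrite ltr_wpDl.
have early k : weight R N k / (k%:R + 2) ^+ 2 <= c.
  have k0 := ler0n R k; have k2 : 0 < k%:R + 2 :> R by rewrite ltr_wpDl.
  rewrite ler_pdivrMr ?exprn_gt0// (le_trans (weight_le _ _ _))//.
  rewrite [leRHS](_ : _ = 3 / 2 * (k%:R + 2) ^+ 2 / ((N%:R + 1) * (N%:R + 2)));
    last by rewrite /c mulrAC.
  by apply: ler_wpM2r; [rewrite invr_ge0 mulr_ge0 ?ltW | nra].
have late k : weight R N k / (k%:R + 2) ^+ 2 <= 1 / (k%:R + 1) - 1 / (k%:R + 2).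
  have k0 := ler0n R k; have k2 : 0 < k%:R + 2 :> R by rewrite ltr_wpDl.
  have k1 : 0 < k%:R + 1 :> R by rewrite ltr_wpDl.
  rewrite (@le_trans _ _ (1 / (k%:R + 2) ^+ 2))//.
    by apply: ler_wpM2r; [rewrite invr_ge0 exprn_ge0 ?ltW | exact: weight_le1].
  have -> : 1 / (k%:R + 1) - 1 / (k%:R + 2) = 1 / ((k%:R + 1) * (k%:R + 2)) :> R.
    by field; rewrite !gt_eqF.
  by rewrite ler_wpM2l// lef_pV2 ?posrE ?mulr_gt0 ?exprn_gt0//; nra.
have head m : \sum_(k < m) weight R N k / (k%:R + 2) ^+ 2 <= m%:R * c.
  apply: le_trans (ler_sum _ (fun (k : 'I_m) _ => early k)) _.
  by rewrite sumr_const card_ord mulr_natl.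
have c0 : 0 < c by rewrite divr_gt0 ?mulr_gt0.
have Nc : N%:R * c <= 3 / 2 / (N%:R + 2).
  have -> : N%:R * c = N%:R / (N%:R + 1) * (3 / 2 / (N%:R + 2)).
    by rewrite /c; field; rewrite !gt_eqF.
  by rewrite ler_piMl ?divr_ge0 ?ltW// ltr_pdivrMr// mul1r ltrDl.
have [nN|Nn] := leqP n N.
  rewrite (le_trans (head n))// (@le_trans _ _ (N%:R * c))//.
    by rewrite (ler_wpM2r (ltW c0))// ler_nat.
  by rewrite (le_trans Nc)//; apply: ler_wpM2r; [rewrite invr_ge0 ltW | lra].
rewrite -(subnKC (ltnW Nn)); move: (n - N)%N => m.
suff : \sum_(k < N + m) weight R N k / (k%:R + 2) ^+ 2 <=
    N%:R * c + (1 / (N%:R + 1) - 1 / (N%:R + m%:R + 1)).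
  move=> /le_trans; apply; have m0 := ler0n R m.
  have : 0 <= 1 / (N%:R + m%:R + 1) :> R by rewrite divr_ge0 ?addr_ge0.
  have : 1 / (N%:R + 1) <= 2 / (N%:R + 2) :> R.
    by rewrite ler_pdivrMr// mulrAC ler_pdivlMr//; lra.
  (* the terms before [N], the terms from [N] on, and a margin *)
  have -> : 4 / (N%:R + 2) =
      3 / 2 / (N%:R + 2) + 2 / (N%:R + 2) + 1 / 2 / (N%:R + 2) :> R.
    by field; rewrite gt_eqF.
  have : 0 <= 1 / 2 / (N%:R + 2) :> R by rewrite divr_ge0 ?ltW.
  lra.
elim: m => [|m IH]; first by rewrite addn0 addr0 subrr addr0.
rewrite addnS big_ord_recr /=; have := late (N + m)%N.
have -> : N%:R + m.+1%:R + 1 = N%:R + m%:R + 2 :> R by rewrite -(natr1 m); lra.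
by rewrite natrD; move: IH; lra.
Qed.

(** * Bounds along one realization *)

Section pathwise.
Context (R : realType) (X : normedModType R) (dot : {dot X for idfun}).
Context (T U : X -> X) (p u : X) (x y xi delta : nat -> X) (b : R).
Context (norm_dot : induced_norm dot) (T_ne : nonexpansive T)
  (U_ne : nonexpansive U) (Tp : T p = p) (Up : U p = p) (b01 : 0 <= b <= 1).

Let alpha (n : nat) : R := 2 / (n%:R + 2).
Context (yE : forall n,
  y n = (1 - alpha n) *: (T (x n) + xi n) + alpha n *: u).
Context (xE : forall n,
  x n.+1 = (1 - b) *: (U (y n) + delta n) + b *: y n).

Let r := `|x 0%N - p| + `|u - p|.
Let s n := `|xi n| + `|delta n|.

Let n0 (n : nat) : 0 <= n%:R :> R. Proof. exact: ler0n. Qed.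

Lemma alpha01 n : 0 <= alpha n <= 1.
Proof.
have := n0 n => h; rewrite /alpha divr_ge0 ?ler_pdivrMr ?mul1r; lra.
Qed.

Lemma T_dist z : `|T z - p| <= `|z - p|.
Proof. by rewrite -[in X in `|X| <= _]Tp. Qed.

Lemma U_dist z : `|U z - p| <= `|z - p|.
Proof. by rewrite -[in X in `|X| <= _]Up. Qed.

Lemma y_dist n :
  `|y n - p| <= (1 - alpha n) * (`|x n - p| + `|xi n|) + alpha n * `|u - p|.
Proof.
have /andP[a0 a1] := alpha01 n.
rewrite yE affine_comb_sub (le_trans (norm_affine_comb_le _ _ _)) ?a0//.
rewrite lerD2r ler_wpM2l ?subr_ge0// addrAC (le_trans (ler_normD _ _))// lerD2r.
exact: T_dist.
Qed.

Lemma Uy_dist n : `|U (y n) + delta n - p| <= `|y n - p| + `|delta n|.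
Proof. by rewrite addrAC (le_trans (ler_normD _ _))// lerD2r U_dist. Qed.

Lemma x_dist_step n : `|x n.+1 - p| <= `|y n - p| + `|delta n|.
Proof.
have /andP[b0 b1] := b01.
rewrite xE affine_comb_sub (le_trans (norm_affine_comb_le _ _ _)) ?b0//.
have := Uy_dist n; have := normr_ge0 (delta n); nra.
Qed.

(** The anchor only enters a convex combination with the current iterate, so
    the distance to [p] grows by at most the noise. *)
Lemma y_dist_partial n : `|x n - p| <= r + \sum_(k < n) s k ->
  `|y n - p| + `|delta n| <= r + \sum_(k < n.+1) s k.
Proof.
move=> IH; rewrite big_ord_recr /= /s.
have /andP[a0 a1] := alpha01 n; have := y_dist n.
have S0 : 0 <= \sum_(k < n) s k by apply: sumr_ge0 => i _; rewrite addr_ge0.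
have := normr_ge0 (x 0%N - p).
have := normr_ge0 (u - p); have := normr_ge0 (xi n); rewrite /r in IH *; nra.
Qed.

Lemma x_dist_partial n : `|x n - p| <= r + \sum_(k < n) s k.
Proof.
elim: n => [|n IH]; first by rewrite big_ord0 /r addr0 lerDl.
exact: le_trans (x_dist_step n) (y_dist_partial IH).
Qed.

Context (M : R) (leM : forall n, r + \sum_(k < n) s k <= M).

Lemma x_bound n : `|x n - p| <= M.
Proof. exact: le_trans (x_dist_partial n) (leM n). Qed.

Lemma yd_bound n : `|y n - p| + `|delta n| <= M.
Proof. exact: le_trans (y_dist_partial (x_dist_partial n)) (leM n.+1). Qed.

Lemma u_bound : `|u - p| <= M.
Proof. by apply: le_trans (leM 0%N); rewrite big_ord0 addr0 /r lerDr. Qed.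

Lemma T_u_bound n : `|T (x n) - u| <= 2 * M.
Proof.
have := ler_distD p (T (x n)) u; rewrite (distrC p u).
by have := T_dist (x n); have := x_bound n; have := u_bound; lra.
Qed.

(** The change of the coefficients acts on [T (x n) - u], which is bounded. *)
Lemma y_step n : `|y n.+1 - y n| <= (1 - alpha n.+1) * `|x n.+1 - x n|
  + `|xi n.+1| + `|xi n| + 2 * M * (alpha n - alpha n.+1).
Proof.
have /andP[a0 a1] := alpha01 n; have /andP[a0' a1'] := alpha01 n.+1.
have aa : alpha n.+1 <= alpha n.
  by rewrite /alpha ler_wpM2l// lef_pV2 ?posrE; have := n0 n; rewrite ?mulrS; lra.
have -> : y n.+1 - y n = (1 - alpha n.+1) *: (T (x n.+1) - T (x n))
   + (1 - alpha n.+1) *: xi n.+1 - (1 - alpha n) *: xi n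
   + (alpha n - alpha n.+1) *: (T (x n) - u).
  by rewrite !yE affine_comb_diff.
rewrite (le_trans (ler_normD _ _))// (mulrC (2 * M)).
rewrite lerD//; last first.
  by rewrite normrZ ger0_norm ?subr_ge0// ler_wpM2l ?subr_ge0// T_u_bound.
rewrite (le_trans (ler_normB _ _))// lerD//; last first.
  by rewrite normrZ ger0_norm ?subr_ge0//; have := normr_ge0 (xi n); nra.
rewrite (le_trans (ler_normD _ _))// !normrZ ger0_norm ?subr_ge0//.
by have := T_ne (x n.+1) (x n); have := normr_ge0 (xi n.+1); nra.
Qed.

Lemma x_step n : `|x n.+2 - x n.+1| <= (1 - alpha n.+1) * `|x n.+1 - x n|
  + s n + s n.+1 + 2 * M * (alpha n - alpha n.+1).
Proof.
have /andP[b0 b1] := b01.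
have -> : x n.+2 - x n.+1 = (1 - b) *: (U (y n.+1) - U (y n) + delta n.+1 - delta n)
     + b *: (y n.+1 - y n).
  rewrite !xE opprD addrACA -!scalerBr opprD addrACA.
  by rewrite [in LHS]addrA.
rewrite (le_trans (norm_affine_comb_le _ _ _)) ?b0//.
have := y_step n; have := U_ne (y n.+1) (y n).
have := ler_normB (U (y n.+1) - U (y n) + delta n.+1) (delta n).
have := ler_normD (U (y n.+1) - U (y n)) (delta n.+1).
have := normr_ge0 (delta n); have := normr_ge0 (delta n.+1); rewrite /s.
set A := `|_ - delta n|; set B := `| _ + delta n.+1|; set C := `|_ - U _|.
set V := `|y _ - _|; set G := (1 - _) * _.
nra.
Qed.

(** [1 - alpha n.+1] is [(n+1)/(n+3)] and [alpha n - alpha n.+1] is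
    [2/((n+2)(n+3))], hence [(n+1)(n+2)] is the factor that makes the step
    recursion telescope. *)
Lemma x_step_partial n :
  (n%:R + 1) * (n%:R + 2) * `|x n.+1 - x n| <=
  4 * M * (n%:R + 1) + \sum_(k < n) (k%:R + 2) * (k%:R + 3) * (s k + s k.+1).
Proof.
elim: n => [|n IH].
  rewrite big_ord0 addr0; have := ler_distD p (x 1%N) (x 0%N).
  by rewrite (distrC p); have := x_bound 0; have := x_bound 1; lra.
rewrite big_ord_recr /=; move: IH.
set Sg := \sum_(_ < _) _ => IH; have := x_step n; have := n0 n.
rewrite /alpha -!(natr1 n) => nn h.
move: IH; set A := `|x n.+2 - _| in h *; set B := `|x n.+1 - _| in h * => IH.
have {h} : (n%:R + 2) * (n%:R + 3) * A <= (n%:R + 2) * (n%:R + 3) *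
   ((1 - 2 / (n%:R + 1 + 2)) * B + s n + s n.+1
    + 2 * M * (2 / (n%:R + 2) - 2 / (n%:R + 1 + 2))).
  by rewrite ler_wpM2l// mulr_ge0// addr_ge0.
rewrite [X in _ <= X -> _](_ : _ =
   (n%:R + 1) * (n%:R + 2) * B
   + (n%:R + 2) * (n%:R + 3) * (s n + s n.+1) + 4 * M); first by nra.
by field; apply/andP; split; lra.
Qed.

Context (N : nat) (W : R).
Context (leW : forall n, \sum_(k < n) weight R N k * s k <= W) (WM : W <= M).

Let S := M / (N%:R + 2) + W.

Let s_ge0 n : 0 <= s n. Proof. by rewrite addr_ge0. Qed.

Let W_ge0 : 0 <= W. Proof. by have := leW 0; rewrite big_ord0. Qed.

Let MN_ge0 : 0 <= M / (N%:R + 2).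
Proof. by rewrite divr_ge0 ?addr_ge0// (le_trans W_ge0). Qed.

Let MNn n : (N <= n)%N -> M / (n%:R + 2) <= M / (N%:R + 2).
Proof.
move=> Nn; rewrite ler_wpM2l ?(le_trans W_ge0)// lef_pV2 ?posrE ?lerD2r ?ler_nat//.
all: by rewrite ltr_wpDl.
Qed.

Lemma noise_small n : (N <= n)%N -> s n <= S.
Proof.
move=> Nn; rewrite (le_trans _ (_ : W <= S)) ?lerDr//.
rewrite (le_trans _ (leW n.+1))// big_ord_recr /= weight_late// mul1r lerDr.
by rewrite sumr_ge0// => k _; rewrite mulr_ge0 ?weight_ge0.
Qed.

Lemma anchor_small n : (N <= n)%N -> 2 * M * alpha n <= 4 * S.
Proof. by move=> Nn; rewrite /alpha; have := MNn Nn; have := W_ge0; rewrite /S; lra. Qed.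

Lemma step_small n : (N <= n)%N -> `|x n.+1 - x n| <= 4 * S.
Proof.
move=> Nn; have nn := n0 n.
have n12 : 0 < (n%:R + 1) * (n%:R + 2) :> R by rewrite mulr_gt0 ?ltr_wpDl.
rewrite -(ler_pM2l n12) (le_trans (x_step_partial n))//.
have h1 : 4 * M * (n%:R + 1) <= (n%:R + 1) * (n%:R + 2) * (4 * (M / (N%:R + 2))).
  have : M <= (n%:R + 2) * (M / (N%:R + 2)).
    rewrite -ler_pdivrMl ?(le_trans _ (MNn Nn)) 1?mulrC//; lra.
  nra.
have h2 : \sum_(k < n) (k%:R + 2) * (k%:R + 3) * (s k + s k.+1)
    <= (n%:R + 1) * (n%:R + 2) * (2 * W).
  apply: (@le_trans _ _ ((n%:R + 1) * (n%:R + 2) *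
     (\sum_(k < n) weight R N k * s k + \sum_(k < n) weight R N k.+1 * s k.+1))).
    rewrite -big_split mulr_sumr ler_sum// => k _ /=.
    have q1 := weight_dom R Nn (ltn_ord k).
    have q2 := le_trans q1 (ler_wpM2r (ltW n12) (weight_leS R N k)).
    have := ler_wpM2r (s_ge0 k) q1; have := ler_wpM2r (s_ge0 k.+1) q2.
    by rewrite !mulrDr; lra.
  rewrite ler_pM2l// mulrDl mul1r lerD//.
  rewrite (le_trans _ (leW n.+1))// big_ord_recl /= lerDr.
  by rewrite mulr_ge0 ?weight_ge0.
by have := lerD h1 h2; have := mulr_ge0 (ltW n12) W_ge0; rewrite /S; lra.
Qed.

Context (Lam t : R) (Lam0 : 0 < Lam) (Lamb : Lam <= b <= 1 - Lam) (t0 : 0 < t).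

Let G := t * S + M / t.

Let SMG : 4 * (S * M) <= G ^+ 2.
Proof.
have -> : G ^+ 2 = (t * S - M / t) ^+ 2 + 4 * (S * M).
  by rewrite /G; field; rewrite gt_eqF.
by rewrite lerDr sqr_ge0.
Qed.

Let G_ge0 : 0 <= G.
Proof.
rewrite addr_ge0 ?divr_ge0 ?mulr_ge0 ?addr_ge0// ?(le_trans W_ge0 WM)//; exact: ltW.
Qed.

(** Expanding the square of [x n.+1 - p], a convex combination, bounds the
    square of [U (y n) + delta n - y n] by a difference of squares.  This
    factors into a small term, as a step, the anchor and the noise are all of
    size [S], and a term bounded by [2 * M]; the arithmetic-geometric mean
    inequality replaces the root of the product. *)
Lemma UyD_small n : (N <= n)%N -> Lam * `|U (y n) + delta n - y n| <= 2 * G.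
Proof.
move=> Nn; have /andP[Lb bL] := Lamb; have /andP[b0 b1] := b01.
set v := `|_|; have v0 : 0 <= v by rewrite normr_ge0.
have S0 : 0 <= S by rewrite addr_ge0.
have M0 : 0 <= M by exact: le_trans WM.
have vE : b * (1 - b) * v ^+ 2 = (1 - b) * `|U (y n) + delta n - p| ^+ 2
   + b * `|y n - p| ^+ 2 - `|x n.+1 - p| ^+ 2.
  have -> : x n.+1 - p = (1 - b) *: (U (y n) + delta n - p) + b *: (y n - p).
    by rewrite xE affine_comb_sub.
  rewrite (sqr_norm_convex _ _ _ norm_dot).
  have -> : U (y n) + delta n - p - (y n - p) = U (y n) + delta n - y n.
    by rewrite opprB addrA subrK.
  by rewrite -/v; ring.
have LamE : Lam ^+ 2 <= b * (1 - b).
  by rewrite expr2; apply: ler_pM; rewrite ?(ltW Lam0)// lerBrDr addrC -lerBrDr.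
set Y := `|y n - p| + `|delta n|; set Z := `|x n.+1 - p|.
have YZ : b * (1 - b) * v ^+ 2 <= Y ^+ 2 - Z ^+ 2.
  rewrite vE; have := Uy_dist n; rewrite -/Y -/Z => q.
  have q2 : `|U (y n) + delta n - p| ^+ 2 <= Y ^+ 2 by rewrite ler_sqr ?nnegrE ?addr_ge0.
  have y2 : `|y n - p| ^+ 2 <= Y ^+ 2 by rewrite ler_sqr ?nnegrE ?addr_ge0// lerDl.
  have b1' : 0 <= 1 - b by rewrite subr_ge0.
  by have := ler_wpM2l b1' q2; have := ler_wpM2l b0 y2; lra.
(* 4 S for the step, S for the noise and 2 S for the anchor *)
have ZY : 0 <= Y - Z <= 7 * S.
  rewrite subr_ge0 x_dist_step /=.
  have := y_dist n; have := noise_small Nn; have := step_small Nn.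
  have := anchor_small Nn; have := ler_distD (x n.+1) (x n) p.
  rewrite (distrC (x n) (x n.+1)) -/Z /s /Y.
  have /andP[a0 a1] := alpha01 n; have := ler_wpM2l a0 u_bound.
  have := mulr_ge0 a0 (normr_ge0 (x n - p)); have := mulr_ge0 a0 (normr_ge0 (xi n)).
  by lra.
have YM : Y <= M by exact: yd_bound.
have Z0 : 0 <= Z by rewrite normr_ge0.
have Y0 : 0 <= Y by rewrite addr_ge0.
have : Y ^+ 2 - Z ^+ 2 <= 16 * (S * M).
  rewrite subr_sqr; move/andP: ZY => [zy0 zy].
  have : (Y - Z) * (Y + Z) <= (7 * S) * (2 * M) by apply: ler_pM; lra.
  have := mulr_ge0 S0 M0; lra.
move=> h; rewrite -ler_sqr ?nnegrE ?mulr_ge0//; last exact: ltW.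
rewrite exprMn (le_trans (ler_wpM2r (sqr_ge0 _) LamE))//.
rewrite (le_trans YZ)// (le_trans h)// exprMn; have := SMG; lra.
Qed.

Let S_le_G : S <= G.
Proof.
have S0 : 0 <= S by rewrite addr_ge0.
have M0 : 0 <= M by exact: le_trans WM.
rewrite -ler_sqr ?nnegrE// (le_trans _ SMG)//.
have : M / (N%:R + 2) <= M by rewrite ler_pdivrMr; have := n0 N; nra.
by have := WM; rewrite /S in S0 *; nra.
Qed.

Let y_x_close n : (N <= n)%N ->
  `|y n - x n| <= 4 * S + `|U (y n) + delta n - y n|.
Proof.
move=> Nn; have := ler_distD (x n.+1) (y n) (x n); have := step_small Nn.
have -> : y n - x n.+1 = - ((1 - b) *: (U (y n) + delta n - y n)).
  rewrite xE -opprB; congr (- _).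
  by rewrite affine_comb_sub subrr scaler0 addr0.
move/andP: b01 => [b0 b1]; rewrite normrN normrZ ger0_norm ?subr_ge0//.
by have := normr_ge0 (U (y n) + delta n - y n); nra.
Qed.

Let Lam_half : Lam <= 1 / 2. Proof. by move/andP: Lamb; lra. Qed.

Let residual_small z v : z <= 9 * S + 3 * v -> Lam * v <= 2 * G ->
  Lam * z <= 11 * G.
Proof.
move=> zv LvG; have S0 : 0 <= S by rewrite addr_ge0.
have := ler_wpM2l (ltW Lam0) zv; have := ler_wpM2r S0 Lam_half.
by have := S_le_G; lra.
Qed.

(** [U] is nonexpansive, so its residual at [x n] exceeds the one at [y n] by
    at most twice the distance of these points, which is small because
    [x n.+1] is close to [x n] and lies between [y n] and
    [U (y n) + delta n]. *)
Lemma resU_small n : (N <= n)%N -> Lam * `|U (x n) - x n| <= 11 * G.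
Proof.
move=> Nn; apply: (residual_small _ (UyD_small Nn)).
have := y_x_close Nn; have := noise_small Nn.
have := ler_distD (U (y n)) (U (x n)) (x n).
have := ler_distD (y n) (U (y n)) (x n).
have := U_ne (x n) (y n); rewrite (distrC (x n)).
have : `|U (y n) - y n| <= `|U (y n) + delta n - y n| + `|delta n|.
  by rewrite -{1}(addrK (delta n) (U (y n))) addrAC ler_normB.
by rewrite /s; have := normr_ge0 (xi n); lra.
Qed.

(** [y n] differs from [T (x n)] by the anchor and the noise only. *)
Lemma resT_small n : (N <= n)%N -> Lam * `|T (x n) - x n| <= 11 * G.
Proof.
move=> Nn; apply: (residual_small _ (UyD_small Nn)).
have := y_x_close Nn; have := noise_small Nn.
have := ler_distD (y n) (T (x n)) (x n).
have /andP[a0 a1] := alpha01 n.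
have : `|T (x n) - y n| <= `|xi n| + 2 * M * alpha n.
  have -> : T (x n) - y n = alpha n *: (T (x n) - u) - (1 - alpha n) *: xi n.
    rewrite -opprB yE affine_comb_sub opprD addrC; congr (_ + _).
      by rewrite -scalerN opprB.
    by rewrite addrAC subrr add0r.
  rewrite (le_trans (ler_normB _ _))// !normrZ !ger0_norm ?subr_ge0//.
  have := ler_wpM2l a0 (T_u_bound n); have := mulr_ge0 a0 (normr_ge0 (xi n)).
  by rewrite -[2 / _]/(alpha n); lra.
have := anchor_small Nn.
have := normr_ge0 (U (y n) + delta n - y n); have := normr_ge0 (delta n).
by rewrite /s; lra.
Qed.

End pathwise.

(** * Integrals of the dominating functionals *)

Lemma nneseries_le_fin (R : realType) (f : nat -> R) (C : R) :
  (forall k, 0 <= f k) -> (forall n, \sum_(k < n) f k <= C) ->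
  (\sum_(0 <= k <oo) (f k)%:E <= C%:E)%E.
Proof.
move=> f0 fC; apply: lime_le; first by apply: is_cvg_nneseries => n _ _; rewrite lee_fin.
by near=> n; rewrite sumEFin lee_fin big_mkord.
Unshelve. all: by end_near.
Qed.

Lemma partial_le_nneseries (R : realType) (f : nat -> R) (n : nat) :
  (forall k, 0 <= f k) ->
  ((\sum_(k < n) f k)%:E <= \sum_(0 <= k <oo) (f k)%:E)%E.
Proof.
move=> f0; rewrite -(big_mkord xpredT f) -sumEFin.
by apply: nneseries_lim_ge => k _ _; rewrite lee_fin.
Qed.

Section envelope.
Context d (Omega : measurableType d) (R : realType) (P : probability Omega R).
Context (r : Omega -> R) (s : nat -> Omega -> R).
Context (mr : measurable_fun setT r) (ms : forall k, measurable_fun setT (s k)).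
Context (r0 : forall w, 0 <= r w) (s0 : forall k w, 0 <= s k w).

(** A bound for the distances to [p] of the whole trajectory, extended real
    because it is finite only almost surely. *)
Definition total_size (w : Omega) : \bar R :=
  ((r w)%:E + \sum_(0 <= k <oo) (s k w)%:E)%E.

Definition weighted_noise (N : nat) (w : Omega) : \bar R :=
  (\sum_(0 <= k <oo) (weight R N k * s k w)%:E)%E.

Let ws0 N k w : 0 <= weight R N k * s k w.
Proof. by rewrite mulr_ge0 ?weight_ge0. Qed.

Let mws N k : measurable_fun setT (fun w => (weight R N k * s k w)%:E).
Proof. by apply/measurable_EFinP/measurable_funM. Qed.

Let mes k : measurable_fun setT (fun w => (s k w)%:E).
Proof. exact/measurable_EFinP. Qed.

Let sum_s0 w : (0 <= \sum_(0 <= k <oo) (s k w)%:E)%E.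
Proof. by apply: nneseries_ge0 => k _ _; rewrite lee_fin. Qed.

Let msum_s : measurable_fun setT (fun w => \sum_(0 <= k <oo) (s k w)%:E)%E.
Proof.
by apply: (ge0_emeasurable_sum (P := xpredT)) => // k w _ _; rewrite lee_fin.
Qed.

Lemma measurable_total_size : measurable_fun setT total_size.
Proof. by apply: emeasurable_funD => //; exact/measurable_EFinP. Qed.

Lemma measurable_weighted_noise N : measurable_fun setT (weighted_noise N).
Proof.
apply: (ge0_emeasurable_sum (P := xpredT)) => [k w _ _|k _]; last exact: mws.
by rewrite lee_fin.
Qed.

Lemma total_size_ge0 w : (0 <= total_size w)%E.
Proof. by rewrite adde_ge0 ?lee_fin. Qed.

Lemma weighted_noise_ge0 N w : (0 <= weighted_noise N w)%E.
Proof. by apply: nneseries_ge0 => k _ _; rewrite lee_fin. Qed.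

Let EE f : ('E_P[f] = \int[P]_w (f w)%:E)%E. Proof. by rewrite unlock. Qed.

Lemma integral_total_size (H : R) :
  ('E_P[r] + \sum_(0 <= k <oo) 'E_P[s k] <= H%:E)%E ->
  (\int[P]_w total_size w <= H%:E)%E.
Proof.
apply: le_trans; rewrite ge0_integralD//; first last.
- exact/measurable_EFinP.
- by move=> w _; rewrite lee_fin.
rewrite integral_nneseries//; last by move=> k w _; rewrite lee_fin.
by rewrite EE (eq_eseriesr (fun k _ => EE (s k))).
Qed.

Lemma integral_weighted_noise (C : R) (N : nat) : 0 <= C ->
  (forall k, 'E_P[s k] <= (C / (k%:R + 2) ^+ 2)%:E)%E ->
  (\int[P]_w weighted_noise N w <= (4 * C / (N%:R + 2))%:E)%E.
Proof.
move=> C0 sC; rewrite integral_nneseries//; last by move=> k w _; rewrite lee_fin.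
apply: (@le_trans _ _ (\sum_(0 <= k <oo) (C * (weight R N k / (k%:R + 2) ^+ 2))%:E)%E).
  apply: lee_nneseries => [k _ _|k _].
    by apply: integral_ge0 => w _; rewrite lee_fin.
  under eq_integral do rewrite EFinM.
  rewrite ge0_integralZl//; first last.
  - by rewrite lee_fin weight_ge0.
  - by move=> w _; rewrite lee_fin.
  rewrite (_ : C * _ = weight R N k * (C / (k%:R + 2) ^+ 2)); last by ring.
  rewrite EFinM lee_wpmul2l ?lee_fin ?weight_ge0//.
  by have := sC k; rewrite unlock.
apply: nneseries_le_fin => [k|n].
  by rewrite mulr_ge0// divr_ge0 ?weight_ge0// exprn_ge0 ?addr_ge0.
rewrite -mulr_sumr (_ : 4 * C / _ = C * (4 / (N%:R + 2))); last by ring.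
by rewrite ler_wpM2l ?weight_mass.
Qed.

Context (H C Lam : R) (C0 : 0 <= C) (Lam0 : 0 < Lam).
Context (totalH : ('E_P[r] + \sum_(0 <= k <oo) 'E_P[s k] <= H%:E)%E).
Context (sC : forall k, ('E_P[s k] <= (C / (k%:R + 2) ^+ 2)%:E)%E).

(** Transfers a bound that holds in each realization with finite total size to
    the integrable envelope; where the total size is infinite, so is the
    envelope.  Both functionals are series of nonnegative functions, so their
    integrals are computed termwise. *)
Lemma envelope_dominates (Z : nat -> Omega -> R) :
  (forall w N M W t, (forall n, r w + \sum_(k < n) s k w <= M) ->
     (forall n, \sum_(k < n) weight R N k * s k w <= W) -> W <= M -> 0 < t ->
     forall n, (N <= n)%N ->
     Lam * Z n w <= 11 * (t * (M / (N%:R + 2) + W) + M / t)) ->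
  forall N t, 0 < t -> exists G : Omega -> \bar R,
  [/\ measurable_fun setT G, forall n w, (N <= n)%N -> ((Z n w)%:E <= G w)%E &
      (\int[P]_w G w <=
       (11 / Lam * (H + 4 * C) * t / (N%:R + 2) + 11 / Lam * H / t)%:E)%E].
Proof.
move=> ZG N t t0.
have N2p : 0 < N%:R + 2 :> R by rewrite ltr_wpDl.
pose q1 : R := 11 / Lam * (t / (N%:R + 2) + 1 / t); pose q2 : R := 11 / Lam * t.
have q1p : 0 < q1 by rewrite mulr_gt0 ?addr_gt0 ?divr_gt0.
have q2p : 0 < q2 by rewrite mulr_gt0 ?divr_gt0.
have q1e : (0 <= q1%:E)%E by rewrite lee_fin ltW.
have q2e : (0 <= q2%:E)%E by rewrite lee_fin ltW.
have mt := measurable_total_size; have mw := measurable_weighted_noise N.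
have mG1 : measurable_fun setT (fun w => q1%:E * total_size w)%E.
  exact: measurable_funeM.
have mG2 : measurable_fun setT (fun w => q2%:E * weighted_noise N w)%E.
  exact: measurable_funeM.
exists (fun w => q1%:E * total_size w + q2%:E * weighted_noise N w)%E; split.
- exact: emeasurable_funD.
- move=> n w Nn.
  have [Moo|] := eqVneq (total_size w) +oo%E.
    rewrite Moo gt0_muley ?lte_fin// addye ?leey//.
    by rewrite gt_eqF// (lt_le_trans (ltNyr 0))// mule_ge0// weighted_noise_ge0.
  rewrite -ltey -ge0_fin_numE ?total_size_ge0// => Mfin.
  have WM : (weighted_noise N w <= total_size w)%E.
    rewrite (@le_trans _ _ (\sum_(0 <= k <oo) (s k w)%:E)%E)//.
      apply: lee_nneseries => [k _ _|k _]; first by rewrite lee_fin.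
      by rewrite lee_fin ler_piMl ?weight_le1.
    by rewrite leeDr ?lee_fin.
  have Wfin : weighted_noise N w \is a fin_num.
    rewrite ge0_fin_numE ?weighted_noise_ge0// (le_lt_trans WM)//.
    by rewrite -ge0_fin_numE ?total_size_ge0.
  rewrite -(fineK Mfin) -(fineK Wfin) -!EFinM -EFinD lee_fin.
  set M := fine _; set W := fine _.
  have := ZG w N M W t _ _ _ t0 n Nn.
  have -> : q1 * M + q2 * W = (11 * (t * (M / (N%:R + 2) + W) + M / t)) / Lam.
    by rewrite /q1 /q2; field; rewrite !gt_eqF.
  rewrite ler_pdivlMr// mulrC; apply.
  + move=> m; rewrite -lee_fin fineK// EFinD leeD2l//; exact: partial_le_nneseries.
  + by move=> m; rewrite -lee_fin fineK//; exact: partial_le_nneseries.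
  + by rewrite -lee_fin !fineK.
- rewrite ge0_integralD//.
  + rewrite ge0_integralZl//; last by move=> w _; exact: total_size_ge0.
    rewrite ge0_integralZl//; last by move=> w _; exact: weighted_noise_ge0.
    apply: (@le_trans _ _ (q1%:E * H%:E + q2%:E * (4 * C / (N%:R + 2))%:E)%E).
      apply: leeD; apply: lee_wpmul2l => //.
        exact: integral_total_size.
      exact: integral_weighted_noise.
    rewrite -!EFinM -EFinD lee_fin le_eqVlt; apply/orP; left; apply/eqP.
    by rewrite /q1 /q2; field; rewrite !gt_eqF.
  + by move=> w _; rewrite mule_ge0// total_size_ge0.
  + by move=> w _; rewrite mule_ge0// weighted_noise_ge0.
Qed.

End envelope.

(** * Rates from dominating functions *)

Section rates.
Context d (Omega : measurableType d) (R : realType) (P : probability Omega R).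

Lemma measurable_exceed (Z : nat -> Omega -> R) (N : nat) (e : R) :
  (forall n, measurable_fun setT (Z n)) ->
  measurable [set w | exists n, (N <= n)%N /\ e <= Z n w].
Proof.
move=> mZ.
have -> : [set w | exists n, (N <= n)%N /\ e <= Z n w] =
    \bigcup_(n in [set n | (N <= n)%N]) (Z n @^-1` `[e, +oo[).
  apply/seteqP; split=> w /=.
    by move=> [n [Nn en]]; exists n => //=; rewrite in_itv /= en.
  by move=> [n /= Nn]; rewrite in_itv /= andbT => en; exists n.
by apply: bigcup_measurable => n _; rewrite -[X in measurable X]setTI; apply: mZ.
Qed.

(** For all [k], the event that [Z n] exceeds [1/(k+1)] infinitely often is
    contained in events of arbitrarily small probability. *)
Lemma as_rate_cvg (Z : nat -> Omega -> R) (Phi : R -> R -> nat) :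
  (forall n, measurable_fun setT (Z n)) -> (forall n w, 0 <= Z n w) ->
  is_as_rate P Z Phi -> {ae P, forall w, Z n w @[n --> \oo] --> (0 : R)}.
Proof.
move=> mZ Z0 rate.
pose F (k l : nat) := [set w | exists n,
  (Phi l.+1%:R^-1 k.+1%:R^-1 <= n)%N /\ k.+1%:R^-1 <= Z n w].
have mF k l : measurable (F k l) by exact: measurable_exceed.
have Fnull k : P.-negligible (\bigcap_l F k l).
  have mI : measurable (\bigcap_l F k l) by exact: bigcapT_measurable.
  apply/negligibleP => //; apply/eqP; rewrite eq_le measure_ge0 andbT.
  apply/lee_addgt0Pr => e e0; rewrite add0e.
  near \oo => l.
  have le : l.+1%:R^-1 < e by near: l; exact: near_infty_natSinv_lt (PosNum e0).
  rewrite (@le_trans _ _ (P (F k l)))//.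
    by apply: le_measure; rewrite ?inE//; apply: bigcap_inf.
  by rewrite (le_trans (ltW (rate _ _ _ _)))// ?lee_fin ?invr_gt0// ltW.
apply: negligibleS (negligible_bigcup Fnull) => w /= notcvg.
apply: contrapT => notin; apply: notcvg.
apply/cvgrPdist_lt => e e0.
near \oo => k.
have ke : k.+1%:R^-1 < e by near: k; exact: near_infty_natSinv_lt (PosNum e0).
have : ~ (\bigcap_l F k l) w by move=> h; apply: notin; exists k.
move=> /existsNP[l /not_implyP[_ nF]].
exists (Phi l.+1%:R^-1 k.+1%:R^-1) => // n /= ln.
rewrite sub0r normrN ger0_norm// (le_lt_trans _ ke)// leNgt; apply/negP => h.
by apply: nF; exists n; split=> //; exact: ltW.
Unshelve. all: by end_near.
Qed.

Lemma mean_rate_cvg (a : nat -> \bar R) (phi : R -> nat) :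
  (forall n, 0 <= a n)%E -> is_rate a phi -> (a n @[n --> \oo] --> 0)%E.
Proof.
move=> a0 rate.
have fin : \forall n \near \oo, a n \is a fin_num.
  exists (phi 1) => // n /= hn; rewrite ge0_fin_numE//.
  exact: lt_trans (rate _ ltr01 _ hn) (ltry _).
apply/fine_cvgP; split=> //; apply/cvgrPdist_lt => e e0.
exists (phi e) => // n /= hn; have lt := rate e e0 n hn.
rewrite sub0r normrN ger0_norm ?fine_ge0// -lte_fin fineK//.
by rewrite ge0_fin_numE// (lt_trans lt)// ltry.
Qed.

Lemma markov_ge0 (f : Omega -> \bar R) (e : R) : measurable_fun setT f ->
  (forall w, 0 <= f w)%E -> 0 < e ->
  (e%:E * P [set w | e%:E <= f w] <= \int[P]_w f w)%E.
Proof.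
move=> mf f0 e0.
have := @le_integral_comp_abse _ _ _ P _ measurableT f e id
  (@measurable_id _ _ _) (fun r h => h) (fun x y _ _ h => h) mf e0.
rewrite setTI; under eq_set do rewrite gee0_abs//.
by under eq_integral do rewrite gee0_abs//.
Qed.

Context (Z : nat -> Omega -> R) (A B : R).
Context (mZ : forall n, measurable_fun setT (Z n)) (Z0 : forall n w, 0 <= Z n w)
  (B0 : 0 < B).
Context (dominated : forall N t, 0 < t -> exists G : Omega -> \bar R,
  [/\ measurable_fun setT G, forall n w, (N <= n)%N -> ((Z n w)%:E <= G w)%E &
      (\int[P]_w G w <= (A * t / (N%:R + 2) + B / t)%:E)%E]).

(** The value [t = 2B/e] gives half of [e] to the second term of the bound. *)
Lemma dominated_small N (e : R) : 0 < e -> 4 * A * B / e ^+ 2 < N%:R + 2 ->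
  exists G : Omega -> \bar R, [/\ measurable_fun setT G,
    forall n w, (N <= n)%N -> ((Z n w)%:E <= G w)%E & (\int[P]_w G w < e%:E)%E].
Proof.
move=> e0 hN; have t0 : 0 < 2 * B / e by rewrite divr_gt0 ?mulr_gt0.
have [G [mG ZG iG]] := dominated N t0; exists G; split=> //.
apply: le_lt_trans iG _; rewrite lte_fin.
have N2 : 0 < N%:R + 2 :> R by rewrite ltr_wpDl.
have -> : A * (2 * B / e) / (N%:R + 2) + B / (2 * B / e) =
    e / 2 * (4 * A * B / e ^+ 2 / (N%:R + 2)) + e / 2.
  by field; rewrite !gt_eqF.
have : 4 * A * B / e ^+ 2 / (N%:R + 2) < 1 by rewrite ltr_pdivrMr// mul1r.
nra.
Qed.

Lemma dominated_as_rate (Phi : R -> R -> nat) :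
  (forall l e, 0 < l -> 0 < e ->
     4 * A * B / (l * e) ^+ 2 < (Phi l e)%:R + 2) ->
  as_cvg0_with_rate P Z Phi.
Proof.
move=> hPhi; have rate : is_as_rate P Z Phi.
  move=> l e l0 e0.
  have [G [mG ZG iG]] := dominated_small (mulr_gt0 l0 e0) (hPhi l e l0 e0).
  have G0 w : (0 <= G w)%E by apply: le_trans (ZG _ w (leqnn _)); rewrite lee_fin.
  have := le_lt_trans (markov_ge0 mG G0 e0) iG.
  rewrite mulrC EFinM lte_pmul2l// => /(le_lt_trans _); apply.
  apply: le_measure; rewrite ?inE.
  - exact: measurable_exceed.
  - rewrite -[X in measurable X]setTI; exact: emeasurable_fun_c_infty.
  - by move=> w /= [n [Nn en]]; apply: le_trans (ZG n w Nn); rewrite lee_fin.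
by split=> //; apply: as_rate_cvg rate.
Qed.

Lemma dominated_mean_rate (phi : R -> nat) :
  (forall e, 0 < e -> 4 * A * B / e ^+ 2 < (phi e)%:R + 2) ->
  cvg0_with_rate (fun n => 'E_P[Z n])%E phi.
Proof.
move=> hphi; have rate : is_rate (fun n => 'E_P[Z n])%E phi.
  move=> e e0 n hn.
  have [G [mG ZG iG]] := dominated_small e0 (hphi e e0).
  apply: le_lt_trans iG; rewrite unlock; apply: ge0_le_integral => //.
  - by move=> w _; rewrite lee_fin.
  - exact/measurable_EFinP.
  - by move=> w _; exact: ZG.
split=> //; apply: mean_rate_cvg rate => n; exact: expectation_ge0.
Qed.

End rates.

Lemma nat_ceil_ge (R : realType) (q : R) : q <= (nat_ceil q)%:R.
Proof.
by rewrite /nat_ceil natr_absz (le_trans (ceil_ge q))// ler_int ler_norm.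
Qed.

(** [4AB/eta^2] is [242 K (K/2 + 4(K1 + K2)) / (Lam eta)^2], and the
    coefficients 6 and 44 are such that [L] is at least 11 times
    [K/2 + 4(K1 + K2)], while [24 * 11 >= 242].  The parameter [m] is 1 for
    the almost sure rates and a value of the modulus for the rates in mean. *)
Lemma rate_large_enough (R : realType) (K K1 K2 Lam eta q c m : R) :
  0 < K -> 0 <= K1 -> 0 <= K2 -> 0 < Lam -> 0 < eta -> 24 <= c -> 0 < m <= 1 ->
  q = Lam ^+ 2 * eta ^+ 2 * m ^+ 2 ->
  4 * (11 / Lam * (K / 2 + 4 * (K1 + K2))) * (11 / Lam * (K / 2)) / eta ^+ 2 <
  (nat_ceil (c * K * (6%:R * K + 44%:R * K1 + 44%:R * K2) / q))%:R + 2.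
Proof.
move=> K0 K10 K20 L0 e0 c24 /andP[m0 m1] ->.
apply: (@le_lt_trans _ _ (c * K * (6%:R * K + 44%:R * K1 + 44%:R * K2) /
  (Lam ^+ 2 * eta ^+ 2 * m ^+ 2))); last first.
  by rewrite (le_lt_trans (nat_ceil_ge _))// ltrDl.
have K0' := ltW K0; have c0 : 0 <= c by rewrite (le_trans _ c24).
have LE : 0 < Lam ^+ 2 * eta ^+ 2 by rewrite mulr_gt0 ?exprn_gt0.
have m2 : m ^+ 2 <= 1 by rewrite expr2 mulr_ile1 ?(ltW m0).
set L := 6%:R * K + 44%:R * K1 + 44%:R * K2.
have L_ge0 : 0 <= L by rewrite /L; lra.
have h1 : 24 * K * L <= c * K * L by rewrite !ler_wpM2r.
apply: (@le_trans _ _ (c * K * L / (Lam ^+ 2 * eta ^+ 2))); last first.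
  apply: ler_wpM2l; first by rewrite !mulr_ge0.
  rewrite lef_pV2 ?posrE ?mulr_gt0 ?exprn_gt0//.
  exact: ler_piMr (ltW LE) m2.
rewrite (_ : _ / eta ^+ 2 = 242 * K * (K / 2 + 4 * (K1 + K2)) / (Lam ^+ 2 * eta ^+ 2)).
  rewrite ler_pM2r ?invr_gt0// (le_trans _ h1)// -!mulrA (mulrCA 242) (mulrCA 24).
  by apply: ler_wpM2l => //; rewrite /L; lra.
by field; rewrite !gt_eqF.
Qed.

(** * The stochastic Halpern-Mann iteration *)

Theorem theorem4p12 :
  exists a b c : nat,
  forall (R : realType) (d : measure_display) (Omega : measurableType d)
    (P : probability Omega R)
    (X : normedModType R) (dot : {dot X for idfun})
    (T U : X -> X) (x0 u : {RV P >-> borel X})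
    (xi delta : nat -> {RV P >-> borel X})
    (x y : nat -> Omega -> X) (alpha beta_ : nat -> R)
    (beta : R) (p : X) (K0 K1 K2 D E Lambda : R),
  induced_norm dot ->
  separable_space X ->
  nonexpansive T ->
  nonexpansive U ->
  (forall n, alpha n = 2 / (n%:R + 2)) ->
  (forall n, beta_ n = beta) ->
  0 < beta < 1 ->
  (forall w, x 0%N w = x0 w) ->
  (forall n w, y n w =
     (1 - alpha n) *: (T (x n w) + (xi n w : X)) + alpha n *: (u w : X)) ->
  (forall n w, x n.+1 w =
     (1 - beta_ n) *: (U (y n w) + (delta n w : X)) + beta_ n *: y n w) ->
  T p = p ->
  U p = p ->
  0 < K0 ->
  ('E_P[fun w => `|(x0 w : X) - p|%R] <= K0%:E)%E ->
  ('E_P[fun w => `|(u w : X) - p|%R] <= K0%:E)%E ->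
  (\sum_(0 <= n <oo) 'E_P[fun w => `|(delta n w : X)|%R] <= D%:E)%E ->
  (\sum_(0 <= n <oo) 'E_P[fun w => `|(xi n w : X)|%R] <= E%:E)%E ->
  0 <= K1 ->
  0 <= K2 ->
  (forall n, ('E_P[fun w => `|(xi n w : X)|%R]
                <= (K1 / (n%:R + 2) ^+ 2)%R%:E)%E) ->
  (forall n, ('E_P[fun w => `|(delta n w : X)|%R]
                <= (K2 / (n%:R + 2) ^+ 2)%R%:E)%E) ->
  0 < Lambda ->
  Lambda <= beta <= 1 - Lambda ->
  let K := 4 * K0 + 2 * D + 2 * E in
  let L := a%:R * K + b%:R * K1 + c%:R * K2 in
  let resU := fun n w => `|U (x n w) - x n w| in
  let resT := fun n w => `|T (x n w) - x n w| in
  [/\ as_cvg0_with_rate P resU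
        (fun l e => nat_ceil (24 * K * L / (Lambda ^+ 2 * e ^+ 2 * l ^+ 2))),
      as_cvg0_with_rate P resT
        (fun l e => nat_ceil (72 * K * L / (Lambda ^+ 2 * e ^+ 2 * l ^+ 2))) &
      forall mu : R -> R,
        ui_modulus P (fun n w => `|U (y n w) - y n w|) mu ->
        (* lossless normalization: values of mu lie in (0, 1] *)
        (forall e : R, 0 < e -> mu e <= 1) ->
        cvg0_with_rate (fun n => 'E_P[resU n])%E
          (fun e => nat_ceil
             (96 * K * L / (Lambda ^+ 2 * e ^+ 2 * mu (e / 4) ^+ 2)))
        /\
        cvg0_with_rate (fun n => 'E_P[resT n])%E
          (fun e => nat_ceil
             (288 * K * L / (Lambda ^+ 2 * e ^+ 2 * mu (e / 4) ^+ 2)))].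
Proof.
(* sufficient for [rate_large_enough] *)
exists 6%N, 44%N, 44%N.
move=> R d Omega P X dot T U x0 u xi delta x y alpha beta_ beta p K0 K1 K2 D E Lam.
move=> hdot sep Tne Une alphaE beta_E /andP[b0 b1] x0E yE xE Tp Up K00 Ex0 Eu Dsum Esum.
move=> K10 K20 xiK deltaK Lam0 Lamb K L resU resT.
have {}yE n w : y n w = (1 - 2 / (n%:R + 2)) *: (T (x n w) + (xi n w : X))
    + (2 / (n%:R + 2)) *: (u w : X) by rewrite yE alphaE.
have {}xE n w : x n.+1 w = (1 - beta) *: (U (y n w) + (delta n w : X))
    + beta *: y n w by rewrite xE beta_E.
have b01 : 0 <= beta <= 1 by rewrite !ltW.
have mcst (z : X) : measurable_fun setT (fun=> z : borel X) by exact: measurable_cst.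
have mRV (f : {RV P >-> borel X}) : measurable_fun setT (f : Omega -> borel X).
  exact: measurable_funP.
have mZ (c : R) (f : Omega -> borel X) : measurable_fun setT f ->
    measurable_fun setT (fun w => c *: (f w : X) : borel X).
  exact/measurable_continuous_comp/scaler_continuous.
have mB (f g : Omega -> borel X) : measurable_fun setT f -> measurable_fun setT g ->
    measurable_fun setT (fun w => (f w : X) - (g w : X) : borel X).
  move=> mf mg; apply: measurable_add => //.
  apply: (measurable_continuous_comp (h := fun z : X => - z)) => // z.
  exact: opp_continuous.
have mT (f : Omega -> borel X) : measurable_fun setT f ->
    measurable_fun setT (fun w => T (f w) : borel X).
  exact/measurable_continuous_comp/nonexpansive_continuous.
have mU (f : Omega -> borel X) : measurable_fun setT f ->
    measurable_fun setT (fun w => U (f w) : borel X).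
  exact/measurable_continuous_comp/nonexpansive_continuous.
have my n : measurable_fun setT (fun w => x n w : borel X) ->
    measurable_fun setT (fun w => y n w : borel X).
  move=> mx; under eq_fun do rewrite yE.
  apply: measurable_add => //; apply: (mZ _ _ _) => //.
  by apply: measurable_add => //; exact: mT.
have mx n : measurable_fun setT (fun w => x n w : borel X).
  elim: n => [|n IH]; first by under eq_fun do rewrite x0E; exact: mRV.
  under eq_fun do rewrite xE.
  have myn := my n IH.
  apply: measurable_add => //; apply: (mZ _ _ _) => //.
  by apply: measurable_add => //; exact: mU.
pose r (w : Omega) := `|(x 0%N w) - p| + `|(u w : X) - p|.
pose s k (w : Omega) := `|(xi k w : X)| + `|(delta k w : X)|.
have mr1 : measurable_fun setT (fun w => `|x 0%N w - p|).
  by apply: measurable_norm; exact: mB.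
have mr2 : measurable_fun setT (fun w => `|(u w : X) - p|).
  by apply: measurable_norm; exact: mB.
have mxi k : measurable_fun setT (fun w => `|(xi k w : X)|) by exact: measurable_norm.
have mdelta k : measurable_fun setT (fun w => `|(delta k w : X)|).
  exact: measurable_norm.
have mr : measurable_fun setT r by exact: measurable_funD.
have ms k : measurable_fun setT (s k) by exact: measurable_funD.
have r0 w : 0 <= r w by rewrite addr_ge0.
have s0 k w : 0 <= s k w by rewrite addr_ge0.
have ED (f g : Omega -> R) : measurable_fun setT f -> measurable_fun setT g ->
    (forall w, 0 <= f w) -> (forall w, 0 <= g w) ->
    ('E_P[fun w => f w + g w]%R = 'E_P[f] + 'E_P[g])%E.
  move=> mf mg f0 g0; rewrite unlock -ge0_integralD//.
  - by move=> w _; rewrite lee_fin.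
  - exact/measurable_EFinP.
  - by move=> w _; rewrite lee_fin.
  - exact/measurable_EFinP.
have xi0 k : (0 <= 'E_P[fun w => `|(xi k w : X)|%R])%E by exact: expectation_ge0.
have delta0 k : (0 <= 'E_P[fun w => `|(delta k w : X)|%R])%E by exact: expectation_ge0.
have Es k : ('E_P[s k] = 'E_P[fun w => `|(xi k w : X)|%R] +
    'E_P[fun w => `|(delta k w : X)|%R])%E.
  exact: ED.
have D0 : 0 <= D by rewrite -lee_fin (le_trans _ Dsum)// nneseries_ge0.
have E0 : 0 <= E by rewrite -lee_fin (le_trans _ Esum)// nneseries_ge0.
have Kpos : 0 < K by rewrite /K; lra.
have totalK : ('E_P[r] + \sum_(0 <= k <oo) 'E_P[s k] <= (K / 2)%:E)%E.
  have -> : K / 2 = (K0 + K0) + (E + D) by rewrite /K; field.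
  rewrite (EFinD (K0 + K0)) leeD//.
    rewrite ED// EFinD leeD//.
    by under eq_fun do rewrite x0E.
  by rewrite (eq_eseriesr (fun k _ => Es k)) nneseriesD// EFinD leeD.
have sC k : ('E_P[s k] <= ((K1 + K2) / (k%:R + 2) ^+ 2)%:E)%E.
  by rewrite Es mulrDl EFinD leeD.
have C0 : 0 <= K1 + K2 by rewrite addr_ge0.
have domU := envelope_dominates mr ms r0 s0 C0 Lam0 totalK sC (Z := resU).
have domT := envelope_dominates mr ms r0 s0 C0 Lam0 totalK sC (Z := resT).
have {}domU := domU (fun w N M W t hM hW WM t0 n Nn =>
  resU_small hdot Tne Une Tp Up b01 (yE^~ w) (xE^~ w) hM hW WM Lam0 Lamb t0 Nn).
have {}domT := domT (fun w N M W t hM hW WM t0 n Nn =>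
  resT_small hdot Tne Une Tp Up b01 (yE^~ w) (xE^~ w) hM hW WM Lam0 Lamb t0 Nn).
have mresU n : measurable_fun setT (resU n).
  by apply: measurable_norm; apply: mB => //; exact: mU.
have mresT n : measurable_fun setT (resT n).
  by apply: measurable_norm; apply: mB => //; exact: mT.
have resU0 n w : 0 <= resU n w by exact: normr_ge0.
have resT0 n w : 0 <= resT n w by exact: normr_ge0.
have B0 : 0 < 11 / Lam * (K / 2) by rewrite mulr_gt0 ?divr_gt0.
split.
- apply: (dominated_as_rate mresU resU0 B0 domU) => l e l0 e0.
  apply: (rate_large_enough (m := 1)); rewrite ?mulr_gt0 ?ltr01 ?lexx//; ring.
- apply: (dominated_as_rate mresT resT0 B0 domT) => l e l0 e0.
  apply: (rate_large_enough (m := 1)); rewrite ?mulr_gt0 ?ltr01 ?lexx ?ler_nat//; ring.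
move=> mu [_ mu0 _] mu1; split.
- apply: (dominated_mean_rate mresU resU0 B0 domU) => e e0.
  have e4 : 0 < e / 4 by rewrite divr_gt0.
  by apply: (rate_large_enough (m := mu (e / 4))); rewrite ?mu0 ?mu1 ?ler_nat.
- apply: (dominated_mean_rate mresT resT0 B0 domT) => e e0.
  have e4 : 0 < e / 4 by rewrite divr_gt0.
  by apply: (rate_large_enough (m := mu (e / 4))); rewrite ?mu0 ?mu1 ?ler_nat.
Qed.
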